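(* Let $G$ be any graph. The $\aleph_0$-tangles of $S_{\mathrm t}$ are precisely the limits of the inverse system $\{\Gamma_X,\mathfrak f_{X',X},\mathcal X\}$, which in turn are precisely the ends and critical vertex sets of $G$, i.e. $\Theta_{\mathrm t}=\Gamma=\Omega\sqcup\mathrm{crit}(G)$. Explicitly: the map $\tau\mapsto(\varphi_X(\tau)\mid X\in\mathcal X)$ is a bijection from $\Theta_{\mathrm t}$ onto $\Gamma=\varprojlim\Gamma_X$, and $\Gamma=\Omega\sqcup\{\langle Y\rangle\mid Y\in\mathrm{crit}(G)\}$, with $Y\mapsto\langle Y\rangle$ injective.
   Context: $G=(V,E)$ is a graph, $\mathcal X$ is the set of all finite subsets of $V$, directed by inclusion; for $X\in\mathcal X$, $\mathcal C_X$ is the set of components of $G-X$, and for $Y\subseteq X$, $\mathcal C_X(Y)=\{C\in\mathcal C_X\mid N(C)=Y\}$. For $X\subseteq X'\in\mathcal X$, $\mathfrak c_{X',X}\colon\mathcal C_{X'}\to\mathcal C_X$ sends each component of $G-X'$ to the component of $G-X$ including it. $X\in\mathcal X$ is critical if $\mathcal C_X(X)$ is infinite; $\mathrm{crit}(G)$ is the set of critical sets and $\mathrm{crit}(X)$ the set of critical subsets of $X$ (equivalently, the $Y\subseteq X$ with $\mathcal C_X(Y)$ infinite). For $Y\in\mathrm{crit}(G)$ with $Y\not\subseteq X$, $C_X(Y)$ is the unique component of $G-X$ meeting $Y$. A ray is a 1-way infinite path; two rays are equivalent if for every $X\in\mathcal X$ both have a tail in the same component of $G-X$; ends are equivalence classes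 of rays, $\Omega$ is the set of ends, and an end $\omega$ is identified with the family $(C(X,\omega)\mid X\in\mathcal X)\in\varprojlim\mathcal C_X$, where $C(X,\omega)$ is the component of $G-X$ in which its rays have a tail (this identifies $\Omega$ with $\varprojlim\mathcal C_X$, a known theorem of Diestel and Kühn). Separations. A finite order separation of $G$ is a set $\{A,B\}$ with $A\cup B=V$, $A\cap B$ finite and no edge between $A\setminus B$ and $B\setminus A$; its orientations are $(A,B),(B,A)$. $(A,B)\le(C,D)$ means $A\subseteq C$ and $B\supseteq D$. A star is a set $\sigma$ of oriented separations such that any two distinct $(A,B),(D,C)\in\sigma$ satisfy $(A,B)\le(C,D)$; its interior is $\bigcap_{(A,B)\in\sigma}B$. For $\mathcal C\subseteq\mathcal C_X$ put $V[\mathcal C]=\bigcup_{C\in\mathcal C}V(C)$ and $s_{X\to\mathcal C}=(V\setminus V[\mathcal C],X\cup V[\mathcal C])$. For $X=A\cap B$, a finite order separation $\{A,B\}$ corresponds to the bipartition $\{\mathcal C,\mathcal C'\}$ of $\mathcal C_X$ (parts may be empty) with $\{A,B\}=\{V[\mathcal C]\cup X,X\cup V[\mathcal C']\}$. Tameness. $\mathcal C\subseteq\mathcal C_X$ is tame if for no $Y\in\mathrm{crit}(X)$ both $\mathcal C_X(Y)\cap\mathcal C$ and $\mathcal C_X(Y)\setminus\mathcal C$ are infinite. A finite order separation is tame if both parts of its corresponding bipartition are tame. $P^{\mathrm t}_X$ is the set of tame subsets of $\mathcal C_X$, ordered by inclusion; $S_{\mathrm t}$ is the set of tame finite order separations.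 An $\aleph_0$-tangle of $S_{\mathrm t}$ is a set $\tau$ containing exactly one orientation of each element of $S_{\mathrm t}$ (and nothing else), that is consistent (no two distinct $(B,A),(C,D)\in\tau$ satisfy $(A,B)<(C,D)$) and has no finite star of finite interior as a subset. $\Theta_{\mathrm t}$ is the set of all $\aleph_0$-tangles of $S_{\mathrm t}$. Inverse system. $\Gamma_X=\mathcal C_X\sqcup\mathrm{crit}(X)$ for $X\in\mathcal X$. For $X\subseteq X'$, $\mathfrak f_{X',X}\colon\Gamma_{X'}\to\Gamma_X$ is $\mathfrak c_{X',X}$ on $\mathcal C_{X'}$, the identity on $\mathrm{crit}(X')\cap\mathrm{crit}(X)$, and sends each $Y\in\mathrm{crit}(X')\setminus\mathrm{crit}(X)$ to $C_X(Y)$. $\Gamma=\varprojlim(\Gamma_X\mid X\in\mathcal X)$. For $Y\in\mathrm{crit}(G)$, $\langle Y\rangle=(p_X\mid X\in\mathcal X)\in\Gamma$ is defined by $p_X=Y$ if $X\supseteq Y$ and $p_X=C_X(Y)$ otherwise. The maps $\varphi_X\colon\Theta_{\mathrm t}\to\Gamma_X$. For $\tau\in\Theta_{\mathrm t}$ let $F(\tau,X)=\{\mathcal C\in P^{\mathrm t}_X\mid s_{X\to\mathcal C}\in\tau\}$. $\varphi_X(\tau)$ is the unique element of $\Gamma_X$ (it exists and is unique) that is either a component $C\in\mathcal C_X$ with $F(\tau,X)=\{\mathcal C\in P^{\mathrm t}_X\mid C\in\mathcal C\}$, or a $Y\in\mathrm{crit}(X)$ with $F(\tau,X)=\{\mathcal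 C\in P^{\mathrm t}_X\mid\mathcal C_X(Y)\setminus\mathcal C\text{ is finite}\}$. *)

(* Defs.v *)
From mathcomp Require Import all_boot all_classical.

Set Implicit Arguments.
Unset Strict Implicit.
Unset Printing Implicit Defensive.

Local Open Scope classical_set_scope.

Record graph := Graph {
  vertex :> Type;
  adj : vertex -> vertex -> Prop;
  adj_sym : forall u v, adj u v -> adj v u;
  adj_irrefl : forall v, ~ adj v v }.

(* The finite vertex sets; sets of vertices that are known to be finite from
   the context are otherwise plain elements of [set G]. *)
Definition finsub (G : graph) := {X : set G | finite_set X}.

Definition finsub_set (G : graph) (X : finsub G) : set G := sval X.
Coercion finsub_set : finsub >-> set.

Section Components.
Variable G : graph.
Implicit Types (U X Y C : set G) (CC : set (set G)).

Inductive walk U : G -> G -> Prop :=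
| walk_refl u : U u -> walk U u u
| walk_step u v w : U u -> adj u v -> walk U v w -> walk U u w.

Definition connected_set U :=
  U !=set0 /\ forall u v, U u -> U v -> walk U u v.

(* Components are represented by their vertex sets: [components X] is the set
   C_X of the components of G - X. *)
Definition components X : set (set G) :=
  [set C | [/\ C `<=` ~` X, connected_set C &
    forall D, D `<=` ~` X -> connected_set D -> C `<=` D -> D `<=` C]].

Definition neighborhood C : set G :=
  [set v | ~ C v /\ exists2 u, C u & adj u v].

Definition components_nbr X Y : set (set G) :=
  [set C | components X C /\ neighborhood C = Y].

Definition crit : set (set G) :=
  [set X | finite_set X /\ infinite_set (components_nbr X X)].

Definition crit_sub X : set (set G) := [set Y | crit Y /\ Y `<=` X].

(* [get P] is an element of P whenever P is nonempty; [component_map_spec],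
   [component_meeting_spec] and [end_component_spec] below show that the
   descriptions it is used for have exactly one solution. *)
Definition component_map X C : set G :=
  get [set D | components X D /\ C `<=` D].

Definition component_meeting X Y : set G :=
  get [set C | components X C /\ C `&` Y !=set0].

Definition union_vertices CC : set G := \bigcup_(C in CC) C.

Definition tame X CC :=
  ~ exists Y, [/\ crit_sub X Y,
                  infinite_set (components_nbr X Y `&` CC) &
                  infinite_set (components_nbr X Y `\` CC)].

Definition tame_sets X : set (set (set G)) :=
  [set CC | CC `<=` components X /\ tame X CC].

End Components.

Section Separations.
Variable G : graph.

Definition oriented := (set G * set G)%type.
Implicit Types (p q : oriented) (tau sigma : set oriented).

Definition flip p : oriented := (p.2, p.1).

(* A separation {A,B} is represented by either of the pairs (A,B), (B,A);
   [is_separation] and [is_tame_separation] are invariant under [flip]. *)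
Definition is_separation p :=
  [/\ p.1 `|` p.2 = setT, finite_set (p.1 `&` p.2) &
    forall u v, (p.1 `\` p.2) u -> (p.2 `\` p.1) v -> ~ adj u v].

Definition sep_le p q := p.1 `<=` q.1 /\ q.2 `<=` p.2.
Definition sep_lt p q := sep_le p q /\ p <> q.

Definition corresponds p (CC CC' : set (set G)) :=
  let X := p.1 `&` p.2 in
  [/\ CC `|` CC' = components X, CC `&` CC' = set0,
      p.1 = union_vertices CC `|` X & p.2 = X `|` union_vertices CC'].

Definition is_tame_separation p :=
  is_separation p /\
  exists CC CC', [/\ corresponds p CC CC', tame (p.1 `&` p.2) CC &
                     tame (p.1 `&` p.2) CC'].

Definition is_star sigma :=
  forall p q, sigma p -> sigma q -> p <> q -> sep_le p (flip q).

Definition star_interior sigma : set G := \bigcap_(p in sigma) p.2.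

Definition orients_tame tau :=
  tau `<=` is_tame_separation /\
  forall p, is_tame_separation p ->
    exists! q, (q = p \/ q = flip p) /\ tau q.

Definition consistent tau :=
  forall p q, tau p -> tau q -> p <> q -> ~ sep_lt (flip p) q.

(* Theta_t, the aleph_0-tangles of S_t. *)
Definition tame_tangles : set (set oriented) :=
  [set tau | [/\ orients_tame tau, consistent tau &
    ~ exists sigma, [/\ sigma `<=` tau, finite_set sigma, is_star sigma &
                        finite_set (star_interior sigma)]]].

Definition sep_to (X : set G) (CC : set (set G)) : oriented :=
  (~` union_vertices CC, X `|` union_vertices CC).

End Separations.

Section InverseSystem.
Variable G : graph.

Definition inv_limit (T : Type) (D : finsub G -> set T)
    (f : finsub G -> finsub G -> T -> T) : set (finsub G -> T) :=
  [set p | (forall X, D X (p X)) /\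
           (forall X X' : finsub G, (X `<=` X')%classic ->
              f X' X (p X') = p X)].

(* In this sum [inl] tags components and [inr] tags critical sets. *)
Definition place := (set G + set G)%type.

Definition Gamma_ (X : finsub G) : set place :=
  [set p | match p with
           | inl C => components X C
           | inr Y => crit_sub X Y
           end].

(* The values of the bonding map f_{X',X} do not depend on X' beyond its
   domain. *)
Definition bonding (X' X : finsub G) (p : place) : place :=
  match p with
  | inl C => inl (component_map X C)
  | inr Y => if `[< crit_sub X Y >] then inr Y
             else inl (component_meeting X Y)
  end.

Definition Gamma : set (finsub G -> place) := inv_limit Gamma_ bonding.

Definition crit_point (Y : set G) : finsub G -> place :=
  fun X => if `[< Y `<=` X >] then inr Y else inl (component_meeting X Y).

Definition tangle_filter (tau : set (oriented G)) (X : finsub G) :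
    set (set (set G)) :=
  [set CC | tame_sets X CC /\ tau (sep_to X CC)].

Definition phi_spec (tau : set (oriented G)) (X : finsub G) (p : place) :=
  Gamma_ X p /\
  match p with
  | inl C => tangle_filter tau X = [set CC | tame_sets X CC /\ CC C]
  | inr Y => tangle_filter tau X =
      [set CC | tame_sets X CC /\ finite_set (components_nbr X Y `\` CC)]
  end.

(* The default value [inl set0] lies in no [Gamma_ X]. *)
Definition phi (X : finsub G) (tau : set (oriented G)) : place :=
  xget (inl set0) (phi_spec tau X).

End InverseSystem.

Section Ends.
Variable G : graph.
Implicit Types (r : nat -> G) (omega : set (nat -> G)).

Definition is_ray r := injective r /\ forall n, adj (r n) (r n.+1).

Definition has_tail_in r (C : set G) :=
  exists n, forall m, (n <= m)%N -> C (r m).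

Definition ray_equiv r r' :=
  forall X : finsub G,
    exists C, [/\ components X C, has_tail_in r C & has_tail_in r' C].

Definition ends : set (set (nat -> G)) :=
  [set omega | exists2 r, is_ray r &
    omega = [set r' | is_ray r' /\ ray_equiv r r']].

Definition end_component (X : set G) omega : set G :=
  get [set C | components X C /\ forall r, omega r -> has_tail_in r C].

Definition end_point omega : finsub G -> place G :=
  fun X => inl (end_component X omega).

End Ends.

Section WellDefined.
Variable G : graph.
Implicit Types (U X Y C : set G).

Lemma walk_sub U U' u v : U `<=` U' -> walk U u v -> walk U' u v.
Proof.
move=> sUU'; elim=> [x /sUU'|x y z /sUU' Ux xy _]; first exact: walk_refl.
exact: walk_step Ux xy.
Qed.

Lemma walk_trans U u v w : walk U u v -> walk U v w -> walk U u w.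
Proof. by elim=> // x y z Ux xy _ IH /IH; apply: walk_step Ux xy. Qed.

Lemma walk_mem U u v : walk U u v -> U u /\ U v.
Proof. by elim=> [|x y z ? _ _ []]. Qed.

Lemma walk_edge U u v : U u -> U v -> adj u v -> walk U u v.
Proof. by move=> Uu Uv uv; apply: walk_step Uu uv (walk_refl Uv). Qed.

Lemma walk_sym U u v : walk U u v -> walk U v u.
Proof.
elim=> [x ?|x y z Ux xy yz zy]; first exact: walk_refl.
apply: walk_trans zy _; apply: walk_edge (adj_sym xy) => //.
by have [] := walk_mem yz.
Qed.

Lemma connected_setU U U' :
  connected_set U -> connected_set U' -> U `&` U' !=set0 ->
  connected_set (U `|` U').
Proof.
move=> [_ cU] [_ cU'] [x [Ux U'x]]; split; first by exists x; left.
have wx u : (U `|` U') u -> walk (U `|` U') u x.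
  by case=> uU; [apply: walk_sub (cU _ _ uU Ux)|apply: walk_sub (cU' _ _ uU U'x)];
    move=> ? ?; [left|right].
by move=> u v /wx ux /wx /walk_sym; apply: walk_trans.
Qed.

Lemma components_absorb X C U : components X C -> U `<=` ~` X ->
  connected_set U -> C `&` U !=set0 -> U `<=` C.
Proof.
move=> [sC cC maxC] sU cU CU.
apply: subset_trans (maxC (C `|` U) _ _ _); first exact: subsetUr.
- by rewrite subUset.
- exact: connected_setU.
- exact: subsetUl.
Qed.

Lemma components_eq X C D : components X C -> components X D ->
  C `&` D !=set0 -> C = D.
Proof.
move=> cC cD CD; apply/seteqP; split.
- by case: (cC) => sC cnC _; apply: (components_absorb cD sC cnC); rewrite setIC.
- by case: (cD) => sD cnD _; apply: (components_absorb cC sD cnD).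
Qed.

Lemma component_exists X U : connected_set U -> U `<=` ~` X ->
  exists2 C, components X C & U `<=` C.
Proof.
move=> [[x Ux] cU] sU; pose C := [set v | walk (~` X) x v].
have wC u v : walk (~` X) u v -> C u -> walk C u v.
  elim=> [|a b c Xa ab bc IH Ca]; first by move=> ? ? ?; exact: walk_refl.
  apply: walk_step (ab) (IH _) => //; apply: walk_trans Ca _.
  by apply: walk_edge => //; have [] := walk_mem bc.
exists C; last by move=> v Uv; apply: walk_sub (cU _ _ Ux Uv).
have Cx : C x by apply: walk_refl; exact: sU.
split=> [v Cv||D sD [_ cD] sCD v Dv].
- by have [] := walk_mem Cv.
- split; first by exists x.
  move=> u v Cu Cv; apply: wC => //; apply: walk_trans Cv; exact: walk_sym.
- by apply: walk_sub (cD x v (sCD _ Cx) Dv).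
Qed.

Lemma component_map_spec X X' C : X `<=` X' -> components X' C ->
  components X (component_map X C) /\
  forall D, components X D /\ C `<=` D <-> D = component_map X C.
Proof.
move=> sX cC'; case: (cC') => sC cC _.
have [E cE CE] : exists2 E, components X E & C `<=` E.
  by apply: component_exists => // v /sC nX' /sX.
have [cm Cm] : [set D | components X D /\ C `<=` D] (component_map X C).
  by apply: (getI (x := E)).
split=> // D; split=> [[cD CD]|->//].
by apply: components_eq cD cm _; have [x Cx] := cC.1; exists x; split; auto.
Qed.

Lemma component_meeting_spec X Y : finite_set X -> crit Y -> ~ Y `<=` X ->
  components X (component_meeting X Y) /\
  forall C, components X C /\ C `&` Y !=set0 <-> C = component_meeting X Y.
Proof.
move=> finX [_ infY] /existsNP[y /not_implyP[Yy Xy]].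
have [D [cD nD] DX] :
    exists2 D, components_nbr Y Y D & D `<=` ~` X.
  apply: contrapT => noD; apply: infY.
  pose h (x : G) : set G := get [set C | components Y C /\ C x].
  apply: (@sub_finite_set _ _ (h @` X)); last exact: finite_image.
  move=> D YD; have [x [Dx Xx]] : D `&` X !=set0.
    by apply: contrapT => DX; apply: noD; exists D => // v Dv Xv; apply: DX; exists v.
  exists x => //; have [ch hx] : [set C | components Y C /\ C x] (h x).
    by apply: (getI (x := D)); split=> //; exact: YD.1.
  by apply: (components_eq ch YD.1); exists x.
have [_ [_ cnD] _] := cD.
have YDadj z : Y z -> exists2 u, D u & adj u z.
  by rewrite -nD => -[].
have cU : connected_set (D `|` (Y `\` X)).
  split; first by exists y; right.
  have toD z : (D `|` (Y `\` X)) z -> exists2 u, D u & walk (D `|` (Y `\` X)) z u.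
    case=> [Dz|[Yz Xz]]; first by exists z => //; apply: walk_refl; left.
    have [u Du uz] := YDadj z Yz; exists u => //.
    by apply: walk_edge; [right|left|apply: adj_sym].
  move=> u v /toD[u' Du' uu'] /toD[v' Dv' /walk_sym vv'].
  apply: walk_trans uu' (walk_trans _ vv').
  by apply: walk_sub (cnD _ _ Du' Dv') => ? ?; left.
have sU : D `|` (Y `\` X) `<=` ~` X by move=> v [/DX//|[]].
have [E cE UE] := component_exists cU sU.
have [cm Ym] : [set C | components X C /\ C `&` Y !=set0] (component_meeting X Y).
  by apply: (getI (x := E)); split=> //; exists y; split=> //; apply: UE; right.
have uniE C : components X C -> C `&` Y !=set0 -> C = E.
  move=> cC [z [Cz Yz]]; apply: (components_eq cC cE); exists z; split=> //.
  by apply: UE; right; split=> //; have [/(_ _ Cz)] := cC.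
split=> // C; split=> [[cC CY]|->//].
by rewrite (uniE C) // (uniE (component_meeting X Y)).
Qed.

Lemma ray_tail X (r : nat -> G) : finite_set X -> is_ray r ->
  exists2 C, components X C & has_tail_in r C.
Proof.
move=> finX [injr adjr].
have [n rX] : exists n, forall m, (n <= m)%N -> ~ X (r m).
  have /finite_seqP[s sE] : finite_set (r @^-1` X).
    by apply: finite_preimage => // a b _ _; exact: injr.
  exists (\max_(i <- s) i).+1 => m lt_m Xrm.
  have /= ms : [set` s] m by rewrite -sE.
  by move: lt_m; rewrite ltnNge (leq_bigmax_seq _ ms).
pose T := [set v | exists2 m, (n <= m)%N & v = r m].
have Tr m : (n <= m)%N -> T (r m) by exists m.
have wT m : (n <= m)%N -> walk T (r n) (r m).
  elim: m => [|m IH nm1].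
    rewrite leqn0 => /eqP n0; have -> : r 0 = r n by rewrite n0.
    exact/walk_refl/Tr.
  have [nm|mn] := leqP n m.
    apply: walk_trans (IH nm) _.
    by apply: walk_edge (adjr m); apply: Tr => //; exact: leqW.
  have <- : n = m.+1 by apply/eqP; rewrite eqn_leq nm1 mn.
  exact/walk_refl/Tr.
have cT : connected_set T.
  split; first by exists (r n), n.
  move=> _ _ [a na ->] [b nb ->].
  exact: walk_trans (walk_sym (wT a na)) (wT b nb).
have [C cC TC] : exists2 C, components X C & T `<=` C.
  by apply: component_exists => // _ [m nm ->]; exact: rX.
by exists C => //; exists n => m nm; apply: TC; exists m.
Qed.

Lemma tail_components_eq X (r : nat -> G) C D : components X C ->
  components X D -> has_tail_in r C -> has_tail_in r D -> C = D.
Proof.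
move=> cC cD [a Ca] [b Db]; apply: components_eq cC cD _.
by exists (r (maxn a b)); split; [apply: Ca; rewrite leq_maxl
                                 |apply: Db; rewrite leq_maxr].
Qed.

Lemma end_component_spec (X : finsub G) (omega : set (nat -> G)) :
  ends omega ->
  components X (end_component X omega) /\
  forall C, (components X C /\ forall r, omega r -> has_tail_in r C) <->
            C = end_component X omega.
Proof.
move=> [r ray_r ->]; set om := [set _ | _].
have rr : om r.
  split=> // Y; have [C cC rC] := ray_tail (svalP Y) ray_r.
  by exists C.
have [C cC rC] := ray_tail (svalP X) ray_r.
have omC : forall r', om r' -> has_tail_in r' C.
  move=> r' [_ /(_ X)[D [cD rD r'D]]].
  by rewrite (tail_components_eq cC cD rC rD).
have [cE rE] : [set C | components X C /\ forall r, om r -> has_tail_in r C]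
    (end_component X om).
  by apply: (getI (x := C)).
split=> // D; split=> [[cD rD]|->//].
exact: tail_components_eq cD cE (rD _ rr) (rE _ rr).
Qed.

End WellDefined.

(* Main.v *)
Require Import Defs.
From mathcomp Require Import all_boot all_classical.

(* For a tangle tau and a finite X, the tame sets CC of components of G - X with
   s_{X -> CC} in tau form an ultrafilter in the Boolean algebra of all tame
   sets. Since G - X has only finitely many possible neighbourhoods of
   components, such an ultrafilter is generated by a single component, or
   consists of the tame sets containing almost all components with
   neighbourhood Y, for some critical Y. This is the place phi_X(tau). Pulling
   tame sets back along X <= X' relates the ultrafilters at X and X', hence the
   places, by the bonding map. Conversely a limit of places prescribes an
   ultrafilter at every X, and any finitely many separations chosen in this way
   have infinitely many vertices on their big sides: pull them back to a common
   X', where they have a component in common.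

   A limit that has a critical set as an entry is determined by it. All other
   limits choose a component d X of G - X for every X, compatibly, and a ray
   with a tail in each d X is constructed (Diestel and Kuehn). *)

Set Implicit Arguments.
Unset Strict Implicit.
Unset Printing Implicit Defensive.

Local Open Scope classical_set_scope.

(** * Finite sets and their power sets *)

Lemma finite_set_ind (T : Type) (P : set T -> Prop) :
  P set0 -> (forall x A, finite_set A -> P A -> P (x |` A)) ->
  forall A, finite_set A -> P A.
Proof.
move=> P0 PU A finA.
(* [{classic T}] equips the bare type with the decidable equality that enumeration by a sequence
   requires. *)
have /finite_seqP[s ->] : finite_set (A : set {classic T}) by [].
elim: s => [|x s IH].
  by have -> : [set` [::]] = set0 :> set {classic T} by apply/seteqP; split.
have -> : [set` x :: s] = x |` [set` s] :> set {classic T}.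
  apply/seteqP; split=> y /=; rewrite inE.
    by move=> /predU1P[]; [left|right].
  by case=> [->|ys]; apply/predU1P; [left|right].
by apply: PU => //; apply/(finite_seqP (T := {classic T})); exists s.
Qed.

Lemma finite_powerset (T : Type) (A : set T) :
  finite_set A -> finite_set [set B | B `<=` A].
Proof.
move: A; apply: finite_set_ind => [|x A _ finA].
  by apply: (sub_finite_set _ (finite_set1 set0)) => B /=; rewrite subset0.
apply: (@sub_finite_set _ _
  ([set B | B `<=` A] `|` [set x |` B | B in [set B | B `<=` A]])).
  move=> B sB; have [Bx|Bx] := pselect (B x).
    right; exists (B `\ x) => [y [/sB[->|//]]|]; first by case.
    rewrite eqEsubset; split=> [y [->|[]]//|y By].
    by have [->|?] := pselect (y = x); [left|right].
  by left=> y /[dup] By /sB[yx|//]; rewrite /= in yx; rewrite yx in By.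
by rewrite finite_setU; split=> //; exact: finite_image.
Qed.

(** * Components and their neighbourhoods *)

Section Components.
Variable G : graph.
Implicit Types (X Y C D : set G).

Lemma components_notin X C v : components X C -> C v -> ~ X v.
Proof. by case=> + _ _ => /[apply]. Qed.

Lemma components_neq0 X C : components X C -> C !=set0.
Proof. by case=> _ []. Qed.

Lemma component_containing X v : ~ X v -> exists2 C, components X C & C v.
Proof.
move=> Xv; have cv : connected_set [set v].
  by split=> [|u w -> ->]; [exists v|exact: walk_refl].
have [|C cC vC] := component_exists cv (X := X); first by move=> u ->.
by exists C => //; exact: vC.
Qed.

Lemma components_unique X C D v :
  components X C -> components X D -> C v -> D v -> C = D.
Proof. by move=> cC cD Cv Dv; apply: components_eq cC cD _; exists v. Qed.

Lemma components_adj X C u v :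
  components X C -> C u -> adj u v -> ~ X v -> C v.
Proof.
move=> cC Cu uv Xv; have Xu := components_notin cC Cu.
apply: (components_absorb cC (U := [set u; v])) => [w [] -> //||//|].
- split; first by exists u; left.
  have r w : [set u; v] w -> walk [set u; v] u w.
    by case=> ->; [apply: walk_refl; left|apply: walk_edge; [left|right|]].
  by move=> a b /r ua /r; apply: walk_trans (walk_sym ua).
- by exists u; split=> //; left.
- by right.
Qed.

Lemma neighborhood_component X C : components X C -> neighborhood C `<=` X.
Proof.
by move=> cC v [Cv [u Cu uv]]; apply: contrapT => /(components_adj cC Cu uv).
Qed.

(** A walk that starts in [C] and avoids [X] never leaves [C]: its first vertex outside would be a
    neighbour of [C], hence in [X]. *)
Lemma closed_component X C :
  C `<=` ~` X -> connected_set C -> neighborhood C `<=` X -> components X C.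
Proof.
move=> sC cC nC; split=> // D sD [_ cD] CD v Dv.
have [x Cx] := cC.1.
have Dxv := cD x v (CD x Cx) Dv.
elim: Dxv Cx => // a b c Da ab bc IH Ca; apply: IH.
apply: contrapT => Cb; have [Db _] := walk_mem bc.
by apply: (sD b Db); apply: nC; split=> //; exists a.
Qed.

(** The right-hand side involves [X] only through disjointness from [C], so components with
    neighbourhood [Y] can be carried over from one [X] to another. *)
Lemma components_nbrP X Y C : Y `<=` X ->
  components_nbr X Y C <->
  [/\ C `<=` ~` X, connected_set C & neighborhood C = Y].
Proof.
move=> YX; split=> [[[]]|[sC cC nC]]; first by split.
by split=> //; apply: closed_component; rewrite ?nC.
Qed.

Lemma components_nbr_sub X X' Y : Y `<=` X -> X `<=` X' ->
  components_nbr X' Y `<=` components_nbr X Y.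
Proof.
move=> YX XX' C /components_nbrP-/(_ (subset_trans YX XX'))[sC cC nC].
by apply/components_nbrP => //; split=> // v /sC ? /XX'.
Qed.

Lemma finite_components_meeting X Z :
  finite_set Z -> finite_set [set C | components X C /\ C `&` Z !=set0].
Proof.
move=> finZ; pose h x : set G := xget set0 [set C | components X C /\ C x].
apply: (@sub_finite_set _ _ (h @` Z)); last exact: finite_image.
move=> C [cC [x [Cx Zx]]]; exists x => //.
have [ch hx] : [set C | components X C /\ C x] (h x).
  exact: (xgetI set0 (conj cC Cx : [set C | components X C /\ C x] C)).
exact: components_unique ch cC hx Cx.
Qed.

(** A component with neighbourhood [Y] that avoids [X'] is still a component once [X'] is deleted,
    and only finitely many components meet [X']. *)
Lemma components_nbr_cofinite X X' Y : finite_set X' -> Y `<=` X -> X `<=` X' ->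
  finite_set (components_nbr X Y `\` components_nbr X' Y).
Proof.
move=> finX' YX XX'.
apply: sub_finite_set (finite_components_meeting X finX').
move=> C [XC nX'C]; split; first by case: XC.
apply: contrapT => CX'; apply: nX'C.
have [_ cnC nC] := (components_nbrP C YX).1 XC.
apply/components_nbrP; first exact: subset_trans XX'.
by split=> // v Cv X'v; apply: CX'; exists v.
Qed.

Lemma crit_sub_infinite X Y :
  finite_set X -> crit_sub X Y -> infinite_set (components_nbr X Y).
Proof.
move=> finX [[_ infY] YX] finXY; apply: infY.
apply: sub_finite_set (_ : _ `<=` components_nbr X Y `|`
    (components_nbr Y Y `\` components_nbr X Y)) _.
  by move=> C YC; have [?|?] := pselect (components_nbr X Y C); [left|right].
by rewrite finite_setU; split=> //; exact: components_nbr_cofinite.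
Qed.

Lemma infinite_crit X Y : finite_set X -> Y `<=` X ->
  infinite_set (components_nbr X Y) -> crit Y.
Proof.
move=> finX YX inf; split; first exact: sub_finite_set finX.
by move=> fin; apply/inf/(sub_finite_set _ fin)/components_nbr_sub.
Qed.

Lemma components_nbr_unique X Y Y' C :
  components_nbr X Y C -> components_nbr X Y' C -> Y = Y'.
Proof. by move=> [_ <-] []. Qed.

Lemma component_map_sub X X' C : X `<=` X' -> components X' C ->
  components X (component_map X C) /\ C `<=` component_map X C.
Proof. by move=> XX' /(component_map_spec XX')[_ h]; apply/h. Qed.

Lemma component_mapP X X' C D : X `<=` X' -> components X' C ->
  components X D -> C `<=` D -> component_map X C = D.
Proof.
by move=> XX' cC cD CD; apply/esym/(component_map_spec XX' cC).2.
Qed.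

(** A vertex of [Y] outside [X] is adjacent to every such [C], so all of them fall into the one
    component of G - X containing that vertex. *)
Lemma component_meeting_nbr X X' Y C : finite_set X -> crit Y -> ~ Y `<=` X ->
  X `<=` X' -> components_nbr X' Y C ->
  component_map X C = component_meeting X Y.
Proof.
move=> finX cY YX XX' [cC nC].
have [cM CM] := component_map_sub XX' cC.
apply/(component_meeting_spec finX cY YX).2; split=> //.
have [y /not_implyP[Yy Xy]] := (existsNP _).2 YX.
exists y; split=> //; have : neighborhood C y by rewrite nC.
move=> [_ [u Cu uy]]; apply: components_adj cM _ uy Xy.
exact: CM.
Qed.

End Components.

(** * Tame sets of components *)

Section TameSets.
Variable G : graph.
Implicit Types (X Y C : set G) (CC DD : set (set G)) (p q : oriented G).

Lemma tameP X CC : tame X CC <-> forall Y, crit_sub X Y ->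
  finite_set (components_nbr X Y `&` CC) \/
  finite_set (components_nbr X Y `\` CC).
Proof.
split=> [tCC Y XY|tCC [Y [XY i1 i2]]]; last by case: (tCC Y XY).
by apply: contrapT => /not_orP[? ?]; apply: tCC; exists Y.
Qed.

Lemma tame_sets_compl X CC :
  tame_sets X CC -> tame_sets X (components X `\` CC).
Proof.
move=> [sCC /tameP tCC]; split; first exact: subDsetl.
apply/tameP => Y /tCC[fin|fin]; [right|left]; apply: sub_finite_set fin.
- by move=> C [[cC nC] /not_andP[//|/contrapT]].
- by move=> C [? []].
Qed.

Lemma tame_setsU X CC DD :
  tame_sets X CC -> tame_sets X DD -> tame_sets X (CC `|` DD).
Proof.
move=> [sCC /tameP tCC] [sDD /tameP tDD]; split; first by rewrite subUset.
apply/tameP => Y XY.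
have [f1|f1] := tCC Y XY; last first.
  by right; apply: sub_finite_set f1 => C [? /not_orP[]].
have [f2|f2] := tDD Y XY; last first.
  by right; apply: sub_finite_set f2 => C [? /not_orP[]].
by left; rewrite setIUr finite_setU; split.
Qed.

Lemma tame_sets_bigcup X (A : set (set (set G))) : finite_set A ->
  A `<=` tame_sets X -> tame_sets X (\bigcup_(CC in A) CC).
Proof.
move: A; apply: finite_set_ind => [_|CC A _ IH sA].
  by rewrite bigcup_set0; split=> //; apply/tameP => Y _; left; rewrite setI0.
rewrite bigcup_setU1; apply: tame_setsU; first by apply: sA; left.
by apply: IH => DD ADD; apply: sA; right.
Qed.

Lemma tame_sets_finite X CC :
  CC `<=` components X -> finite_set CC -> tame_sets X CC.
Proof.
move=> sCC fin; split=> //; apply/tameP => Y _; left.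
by apply: sub_finite_set fin => C [].
Qed.

Lemma tame_sets_unionP X CC :
  CC `<=` components X ->
  (forall Y, crit_sub X Y ->
     components_nbr X Y `<=` CC \/ components_nbr X Y `&` CC = set0) ->
  tame_sets X CC.
Proof.
move=> sCC h; split=> //; apply/tameP => Y /h[sub|->]; [right|by left].
by apply: sub_finite_set (finite_set0 (set G)) => C [/sub].
Qed.

Lemma tame_sets_nbr X Y : tame_sets X (components_nbr X Y).
Proof.
apply: tame_sets_unionP => [C []//|Z _].
have [->|ZY] := pselect (Z = Y); [by left|right].
rewrite -subset0 => C [ZC YC]; exact/ZY/(components_nbr_unique ZC YC).
Qed.

Lemma union_verticesP X CC C v : CC `<=` components X -> components X C ->
  C v -> union_vertices CC v -> CC C.
Proof.
move=> sCC cC Cv [D CCD Dv].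
by rewrite (components_unique cC (sCC _ CCD) Cv Dv).
Qed.

Lemma setC_union_vertices X CC : CC `<=` components X ->
  ~` union_vertices CC = X `|` union_vertices (components X `\` CC).
Proof.
move=> sCC; apply/seteqP; split=> [v nv|v [Xv|[C [cC CCC] Cv]]].
- have [Xv|Xv] := pselect (X v); [by left|right].
  have [C cC Cv] := component_containing Xv.
  by exists C => //; split=> // CCC; apply: nv; exists C.
- by move=> [C /sCC cC Cv]; apply: components_notin cC Cv Xv.
- by move/(union_verticesP sCC cC Cv).
Qed.

Lemma union_vertices_notin X CC v : CC `<=` components X ->
  union_vertices CC v -> ~ X v.
Proof. by move=> sCC [C /sCC cC Cv]; apply: components_notin cC Cv. Qed.

Lemma components_setDD X CC : CC `<=` components X ->
  components X `\` (components X `\` CC) = CC.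
Proof. by move=> sCC; rewrite setDD setIidr. Qed.

Lemma flip_sep_to X CC : CC `<=` components X ->
  flip (sep_to X CC) = sep_to X (components X `\` CC).
Proof.
move=> sCC; rewrite /flip /sep_to /=.
rewrite (setC_union_vertices (@subDsetl _ (components X) CC)).
by rewrite components_setDD // (setC_union_vertices sCC).
Qed.

Lemma sep_to_separator X CC : CC `<=` components X ->
  (sep_to X CC).1 `&` (sep_to X CC).2 = X.
Proof.
move=> sCC; rewrite /sep_to /= setIUr setICl setU0 setIidr // => v Xv VCC.
exact: union_vertices_notin sCC VCC Xv.
Qed.

Lemma union_vertices_inj X CC DD : CC `<=` components X ->
  DD `<=` components X -> union_vertices CC = union_vertices DD -> CC = DD.
Proof.
have sub A B : A `<=` components X -> B `<=` components X ->
    union_vertices A = union_vertices B -> A `<=` B.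
  move=> sA sB eqAB C AC; have [v Cv] := components_neq0 (sA C AC).
  apply: (union_verticesP sB (sA C AC) Cv).
  by rewrite -eqAB; exists C.
by move=> sC sD eqV; apply/seteqP; split; apply: sub.
Qed.

(** The two sides meet exactly in the separator, and [CC] is recovered from its vertices because
    components are nonempty and disjoint. *)
Lemma sep_to_inj X Y CC DD : CC `<=` components X -> DD `<=` components Y ->
  sep_to X CC = sep_to Y DD -> X = Y /\ CC = DD.
Proof.
move=> sCC sDD eqs; have XY : X = Y.
  by rewrite -(sep_to_separator sCC) eqs sep_to_separator.
split=> //; apply: (union_vertices_inj sCC); first by rewrite XY.
by have /(congr1 (@setC G)) := congr1 fst eqs; rewrite !setCK.
Qed.

Lemma tame_sep_to (X : finsub G) CC :
  tame_sets X CC -> is_tame_separation (sep_to X CC).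
Proof.
move=> tC; have [sCC tCC] := tC; have [sCC' tCC'] := tame_sets_compl tC.
split; last first.
  exists (components X `\` CC), CC; rewrite /corresponds sep_to_separator //.
  split=> //; split=> //; last 1 first.
  - by rewrite /= (setC_union_vertices sCC) setUC.
  - by rewrite setUC setDUK.
  - by rewrite setDKI.
split; last 1 first.
- move=> u v [/= nu /not_orP[Xu _]] [[Xv|[C CCC Cv]] /contrapT[D CCD Dv]] uv.
    exact: components_notin (sCC _ CCD) Dv Xv.
  apply: nu; exists C => //.
  exact: components_adj (sCC _ CCC) Cv (adj_sym uv) Xu.
- by rewrite /= setUC -setUA setUCr setUT.
- by rewrite sep_to_separator //; exact: svalP.
Qed.

Lemma tame_separationP p : is_tame_separation p <->
  exists (X : finsub G) CC, tame_sets X CC /\ p = sep_to X CC.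
Proof.
split=> [[[_ finX _] [CC [CC' [[CU CI p1 p2] _ tCC']]]]|]; last first.
  by move=> [X [CC [tCC ->]]]; exact: tame_sep_to.
exists (exist _ _ finX), CC'; rewrite /finsub_set /=.
have sCC' : CC' `<=` components (p.1 `&` p.2) by rewrite -CU; exact: subsetUr.
split=> //; rewrite /sep_to (setC_union_vertices sCC') -p2.
rewrite [LHS]surjective_pairing {1}p1 setUC; congr (_ `|` union_vertices _, _).
rewrite -CU setDUl setDv setU0; apply/seteqP; split=> [C CCC|C []//].
by split=> // CC'C; have : (CC `&` CC') C by []; rewrite CI.
Qed.

End TameSets.

(** * The inverse system and pullbacks of tame sets *)

Section Bonding.
Variable G : graph.
Implicit Types (X Y : finsub G) (CC : set (set G)) (g : place G).

(* The sets that belong to the ultrafilter on the tame sets of components of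
   G - X described by the place [g]. *)
Definition concentrates (X : set G) g CC :=
  match g with
  | inl C => CC C
  | inr Y => finite_set (components_nbr X Y `\` CC)
  end.

Definition component_preimage (X' X : set G) CC : set (set G) :=
  [set C | components X' C /\ CC (component_map X C)].

Lemma union_vertices_preimage (X X' : set G) CC : X `<=` X' ->
  CC `<=` components X ->
  union_vertices (component_preimage X' X CC) = union_vertices CC `\` X'.
Proof.
move=> XX' sCC; apply/seteqP; split=> [v [C [cC CCm] Cv]|v [[C CCC Cv] X'v]].
  have [cM CM] := component_map_sub XX' cC.
  split; last exact: components_notin cC Cv.
  by exists (component_map X C) => //; exact: CM.
have [D cD Dv] := component_containing X'v; exists D => //; split=> //.
have [cM DM] := component_map_sub XX' cD.
by rewrite (components_unique cM (sCC _ CCC) (DM _ Dv) Cv).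
Qed.

Lemma components_nbr_map (X X' : set G) (Y : set G) C : Y `<=` X -> X `<=` X' ->
  components_nbr X' Y C -> component_map X C = C.
Proof.
move=> YX XX' YC; apply: (component_mapP XX') => //; first by case: YC.
by have [] := components_nbr_sub YX XX' YC.
Qed.

(** If [Y] lies in [X], the map to the components of G - X fixes each component with neighbourhood
    [Y]. Otherwise it is constant on these components, so the preimage contains all or none of
    them. *)
Lemma tame_component_preimage X X' CC : X `<=` X' -> tame_sets X CC ->
  tame_sets X' (component_preimage X' X CC).
Proof.
move=> XX' [sCC /tameP tCC]; split; first by move=> C [].
apply/tameP => Y [cY YX']; have [YX|YX] := pselect (Y `<=` X).
  have [fin|fin] := tCC Y (conj cY YX); [left|right];
    apply: sub_finite_set fin => C [YC]; have sub := components_nbr_sub YX XX'.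
  - by move=> [_]; rewrite (components_nbr_map YX XX' YC) => ?; split; auto.
  - move=> nC; split; first exact: sub.
    move=> CCC; apply: nC; split; first by case: YC.
    by rewrite (components_nbr_map YX XX' YC).
have meet C : components_nbr X' Y C ->
    component_map X C = component_meeting X Y.
  by apply: component_meeting_nbr => //; exact: (svalP X).
have [CCM|CCM] := pselect (CC (component_meeting X Y)); [right|left];
  apply: sub_finite_set (finite_set0 (set G)) => C [YC].
- by apply; split; [case: YC|rewrite meet].
- by move=> [_]; rewrite meet.
Qed.

Lemma bonding_Gamma X X' g :
  X `<=` X' -> Gamma_ X' g -> Gamma_ X (bonding X' X g).
Proof.
move=> XX'; case: g => [C cC|Y [cY YX']] /=.
  by have [] := component_map_spec XX' cC.
case: asboolP => // nXY.
have YX : ~ Y `<=` X by move=> YX; apply: nXY.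
by have [] := component_meeting_spec (svalP X) cY YX.
Qed.

(** This dictates the form of [bonding]: places move as their ultrafilters do. A critical [Y] inside
    [X] loses only finitely many components; otherwise all components with neighbourhood [Y] map to
    a single one. *)
Lemma concentrates_preimage X X' g CC : X `<=` X' -> Gamma_ X' g ->
  concentrates X' g (component_preimage X' X CC) <->
  concentrates X (bonding X' X g) CC.
Proof.
move=> XX'; case: g => [C cC|Y [cY YX']] /=; first by split=> [[]|].
case: asboolP => [[_ YX]|nXY] /=.
  have sub := components_nbr_sub YX XX'; split=> fin.
    apply: sub_finite_set (_ : _ `<=`
      (components_nbr X Y `\` components_nbr X' Y) `|`
      (components_nbr X' Y `\` component_preimage X' X CC)) _.
      move=> C [XC CCC]; have [X'C|] := pselect (components_nbr X' Y C).
        right; split=> // -[_]; by rewrite (components_nbr_map YX XX').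
      by left.
    rewrite finite_setU; split=> //.
    by apply: components_nbr_cofinite => //; exact: svalP.
  apply: sub_finite_set fin => C [X'C nC]; split; first exact: sub.
  move=> CCC; apply: nC; split; first by case: X'C.
  by rewrite (components_nbr_map YX XX').
have YX : ~ Y `<=` X by move=> YX; apply: nXY.
have meet C : components_nbr X' Y C ->
    component_map X C = component_meeting X Y.
  by apply: component_meeting_nbr => //; exact: (svalP X).
split=> [fin|CCM].
  have [C [X'C nC]] := infinite_setN0
    (infinite_setD (crit_sub_infinite (svalP X') (conj cY YX')) fin).
  by rewrite -(meet _ X'C); apply: contrapT => nCC; apply: nC; split=> // -[].
apply: sub_finite_set (finite_set0 (set G)) => C [YC].
by apply; split; [case: YC|rewrite meet].
Qed.

(** For a critical set, tameness makes one of the two parts of its class finite, and the class is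
    infinite, so not both are. *)
Lemma concentrates_compl X g CC : Gamma_ X g -> tame_sets X CC ->
  concentrates X g (components X `\` CC) <-> ~ concentrates X g CC.
Proof.
case: g => [C cC|Y XY] [_ /tameP tCC] /=; first by split=> [[]//|].
have inf := crit_sub_infinite (svalP X) XY.
have E : components_nbr X Y `\` (components X `\` CC) =
    components_nbr X Y `&` CC.
  apply/seteqP; split=> [C [YC /not_andP[/(_ YC.1)//|/contrapT]]|C [YC CCC]] //.
  by split=> // -[].
rewrite E; split=> [f1 f2|nf]; last by case: (tCC Y XY).
by apply: inf; rewrite -(setUIDK (components_nbr X Y) CC) finite_setU.
Qed.

(** Finitely many finite exceptional sets cannot exhaust the infinite class of a critical set. *)
Lemma concentrates_finite X g (A : set (set (set G))) : Gamma_ X g ->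
  finite_set A -> (forall CC, A CC -> concentrates X g CC) ->
  exists2 C, components X C & forall CC, A CC -> CC C.
Proof.
case: g => [C cC|Y XY] finA /= hA; first by exists C.
have [C [YC nC]] := infinite_setN0 (infinite_setD
  (crit_sub_infinite (svalP X) XY) (bigcup_finite finA hA)).
exists C; first by case: YC.
by move=> CC ACC; apply: contrapT => nCC; apply: nC; exists CC.
Qed.

End Bonding.

(** * Tangles *)

Section TangleFilter.
Variable G : graph.
Implicit Types (X Y : finsub G) (C : set G) (CC DD : set (set G)).
Implicit Types (p q r : oriented G) (tau sigma : set (oriented G)).

Lemma tangle_star tau sigma : tame_tangles tau -> sigma `<=` tau ->
  finite_set sigma -> is_star sigma -> infinite_set (star_interior sigma).
Proof. by move=> [_ _ nstar] st fin star inf; apply: nstar; exists sigma. Qed.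

Lemma tangle_star2 tau p q : tame_tangles tau -> tau p -> tau q ->
  sep_le p (flip q) -> infinite_set (p.2 `&` q.2).
Proof.
move=> tt tp tq pq fin.
apply: (@tangle_star _ [set p; q] tt) => [r [] ->//|//||].
- have qp : sep_le q (flip p) by case: pq.
  by move=> r s [->|->] [->|->].
- by apply: sub_finite_set fin => v vI; split; apply: vI; [left|right].
Qed.

Lemma tangle_infinite tau p : tame_tangles tau -> tau p -> infinite_set p.2.
Proof.
move=> tt tp fin.
apply: (@tangle_star _ [set p] tt) => [_ ->//|//|_ _ -> -> //|].
by apply: sub_finite_set fin => v; apply.
Qed.

Lemma tangle_orient tau p :
  tame_tangles tau -> is_tame_separation p -> tau (flip p) \/ tau p.
Proof.
by move=> [[_ h] _ _] /h[q [[[->|->] tq] _]]; [right|left].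
Qed.

Lemma tangle_flipN tau p : tame_tangles tau -> tau p -> ~ tau (flip p).
Proof.
move=> tt tp tfp; apply: (tangle_star2 tt tp tfp); first by split.
by case: (tt) => -[/(_ p tp)[[_ fin _] _] _] _ _; rewrite setIC.
Qed.

Lemma tangle_le tau p q : tame_tangles tau -> is_tame_separation p ->
  tau q -> sep_le p q -> tau p.
Proof.
move=> tt tp tq pq; have [tfp|//] := tangle_orient tt tp.
(* Consistency only constrains distinct separations. If [flip p = q], then [p.1] lies in [p.2], so
   the big side of [q] is the finite separator. *)
have [fpq|fpq] := pselect (flip p = q).
  rewrite -fpq in tq pq; case: (tangle_infinite tt tq).
  have [[_ fin _] _] := tp; apply: sub_finite_set fin => v p1; split=> //.
  by case: pq => + _; apply.
have [->//|pNq] := pselect (p = q).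
have [_ /(_ _ _ tfp tq fpq) nlt _] := tt; case: nlt.
by split; [case: pq; split|rewrite /flip -surjective_pairing].
Qed.

(** The opposite orientation [flip q] would form with [p] a star whose interior is the finite
    intersection of [p.2] and [q.1]. *)
Lemma tangle_le_finite tau p q : tame_tangles tau -> is_tame_separation q ->
  tau p -> sep_le p q -> finite_set (p.2 `&` q.1) -> tau q.
Proof.
move=> tt tq tp pq fin; have [tfq|//] := tangle_orient tt tq.
by case: (tangle_star2 tt tp tfq).
Qed.

Lemma tangle_compl tau X CC : tame_tangles tau -> tame_sets X CC ->
  tau (sep_to X (components X `\` CC)) <-> ~ tau (sep_to X CC).
Proof.
move=> tt tCC; rewrite -flip_sep_to; last by case: tCC.
split; first by move=> + t2; apply: tangle_flipN.
by have [] := tangle_orient tt (tame_sep_to tCC).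
Qed.

Lemma sep_to_subset (X : set G) CC DD :
  CC `<=` DD -> sep_le (sep_to X DD) (sep_to X CC).
Proof.
have sub v : CC `<=` DD -> union_vertices CC v -> union_vertices DD v.
  by move=> CD [C /CD DDC Cv]; exists C.
by move=> CD; split=> [v + /(sub _ CD)//|v [|/(sub _ CD)]]; [left|right].
Qed.

(** No component is missing from both [CC] and [DD], so the small sides of the two separations meet
    only in [X], as required in a star. *)
Lemma sep_to_le_flip (X : set G) CC DD : CC `<=` components X ->
  DD `<=` components X -> components X `<=` CC `|` DD ->
  sep_le (sep_to X CC) (flip (sep_to X DD)).
Proof.
move=> sC sD cov; split; rewrite /= ?(setC_union_vertices sC);
  rewrite ?(setC_union_vertices sD); move=> v [|[C [cC nC] Cv]]; try by [left];
  by right; exists C => //; have [|] := cov C cC.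
Qed.

Lemma tangle_subset tau X CC DD : tame_tangles tau -> tame_sets X DD ->
  CC `<=` DD -> tau (sep_to X CC) -> tau (sep_to X DD).
Proof.
move=> tt tD CD tC; apply: tangle_le tC _ => //; first exact: tame_sep_to.
exact: sep_to_subset.
Qed.

Lemma tangle_set0 tau X : tame_tangles tau -> ~ tau (sep_to X set0).
Proof.
move=> tt t0; apply: (tangle_infinite tt t0).
by rewrite /= /union_vertices bigcup_set0 setU0; exact: svalP.
Qed.

(* If the union is big but neither [CC] nor [DD] is, then the separations that
   cut off the three sets CC, DD \ CC and the rest form a star in [tau] with
   interior inside [X]. *)
Lemma tangle_setU tau X CC DD : tame_tangles tau -> tame_sets X CC ->
  tame_sets X DD -> tau (sep_to X (CC `|` DD)) ->
  tau (sep_to X CC) \/ tau (sep_to X DD).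
Proof.
move=> tt tC tD tCD; apply: contrapT => /not_orP[].
move=> /(tangle_compl tt tC) n1 /(tangle_compl tt tD) n2.
pose D' := components X `\` (DD `\` CC).
have tD' : tame_sets X D'.
  (* This form reduces tameness to closure under complements and unions. *)
  have -> : D' = (components X `\` DD) `|` CC.
    apply/seteqP; split=> [C [cC /not_andP[nD|/contrapT]]|C [[cC nD]|CCC]];
      [by left|by right|by split=> // -[]|].
    by split=> [|[]//]; apply: tC.1.
  exact: tame_setsU (tame_sets_compl tD) tC.
have {}n2 : tau (sep_to X D').
  by apply: tangle_subset n2 => // C [cC nD]; split=> // -[].
pose s1 := sep_to X (components X `\` CC).
have sC' := (tame_sets_compl tC).1.
have sCD := (tame_setsU tC tD).1.
apply: (@tangle_star _ [set s1; sep_to X D'; sep_to X (CC `|` DD)] tt).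
- by move=> p [[]|] ->.
- by [].
- move=> p q [[->|->]|->] [[->|->]|->] // _; apply: sep_to_le_flip => //;
    try exact: tD'.1; move=> C cC.
  + by have [CCC|nC] := pselect (CC C); [right; split=> // -[]|left].
  + by have [CCC|nC] := pselect (CC C); [right; left|left].
  + by have [CCC|nC] := pselect (CC C); [left; split=> // -[]|right].
  + by have [DDC|nC] := pselect (DD C); [right; right|left; split=> // -[]].
  + by have [CCC|nC] := pselect (CC C); [left; left|right].
  + by have [DDC|nC] := pselect (DD C); [left; right|right; split=> // -[]].
- apply: sub_finite_set (svalP X) => v vI; apply: contrapT => Xv.
  have [C cC Cv] := component_containing Xv.
  have mem E : E `<=` components X ->
      [set s1; sep_to X D'; sep_to X (CC `|` DD)] (sep_to X E) -> E C.
    by move=> sE /vI[//|/(union_verticesP sE cC Cv)].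
  have [_ nC] : (components X `\` CC) C by apply: mem => //; left; left.
  have [_ nDC] : D' C by apply: mem; [exact: tD'.1|left; right].
  by have [|DDC] : (CC `|` DD) C by [apply: mem => //; right] => //; apply: nDC.
Qed.

Lemma tangle_bigcup tau X (A : set (set (set G))) : tame_tangles tau ->
  finite_set A -> A `<=` tame_sets X ->
  tau (sep_to X (\bigcup_(CC in A) CC)) -> exists2 CC, A CC & tau (sep_to X CC).
Proof.
move=> tt; move: A; apply: finite_set_ind => [_|CC A finA IH sA].
  by rewrite bigcup_set0 => /(tangle_set0 tt).
have sA' : A `<=` tame_sets X by move=> DD ADD; apply: sA; right.
have tCC : tame_sets X CC by apply: sA; left.
rewrite bigcup_setU1.
case/(tangle_setU tt tCC (tame_sets_bigcup finA sA')).
  by exists CC => //; left.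
by move=> /(IH sA')[DD ADD tDD]; exists DD => //; right.
Qed.

Lemma tangle_components tau X :
  tame_tangles tau -> tau (sep_to X (components X)).
Proof.
move=> tt; rewrite -[components X]setD0.
apply/tangle_compl => //; [exact: tame_sets_finite|exact: tangle_set0].
Qed.

(** * The place of a tangle at a finite set *)

Lemma phi_specP tau X g : phi_spec tau X g <-> Gamma_ X g /\
  forall CC, tame_sets X CC -> (tau (sep_to X CC) <-> concentrates X g CC).
Proof.
have E (P Q : set (set (set G))) : [set CC | tame_sets X CC /\ P CC] =
    [set CC | tame_sets X CC /\ Q CC] <->
    forall CC, tame_sets X CC -> (P CC <-> Q CC).
  split=> [/seteqP[PQ QP] CC tCC|h].
    by split=> ?; [have [] := PQ CC (conj tCC _)|have [] := QP CC (conj tCC _)].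
  by apply/seteqP; split=> CC [tCC] /(h _ tCC).
by case: g => [C|Y]; split=> -[gX /E].
Qed.

(** Distinct places are told apart by a tame set: the singleton of a component, or the class of a
    critical set. *)
Lemma concentrates_inj X g g' : Gamma_ X g -> Gamma_ X g' ->
  (forall CC, tame_sets X CC ->
     (concentrates X g CC <-> concentrates X g' CC)) -> g = g'.
Proof.
have mix C (Y : set G) : components X C -> crit_sub X Y ->
    ~ (forall CC, tame_sets X CC ->
        (concentrates X (inl C) CC <-> concentrates X (inr Y) CC)).
  move=> cC XY /(_ [set C])[|/(_ erefl) fin _].
    by apply: tame_sets_finite => // _ ->.
  exact: infinite_setD (crit_sub_infinite (svalP X) XY) _ fin.
case: g g' => [C|Y] [C'|Y'] /= Xg Xg' h.
- have [|/(_ erefl) /= -> //] := h [set C].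
  by apply: tame_sets_finite => // _ ->.
- by case: (mix _ _ Xg Xg').
- by case: (mix _ _ Xg' Xg) => CC tCC; apply: iff_sym; exact: h.
- congr inr; apply: contrapT => YY'.
  have [+ _] := h _ (tame_sets_nbr X Y); rewrite setDv => /(_ (finite_set0 _)).
  rewrite setDidl; first exact: crit_sub_infinite (svalP X) Xg'.
  rewrite -subset0 => C [YC Y'C]; exact/YY'/(components_nbr_unique Y'C YC).
Qed.

Lemma phi_spec_unique tau X g g' :
  phi_spec tau X g -> phi_spec tau X g' -> g = g'.
Proof.
move=> /phi_specP[Xg hg] /phi_specP[Xg' hg'].
by apply: (concentrates_inj Xg Xg') => CC tCC; rewrite -hg // -hg'.
Qed.

Lemma phi_spec_exists tau X : tame_tangles tau -> exists g, phi_spec tau X g.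
Proof.
move=> tt.
have [[C cC tC]|nsingle] := pselect (exists2 C, components X C &
    tau (sep_to X [set C])).
  exists (inl C); apply/phi_specP; split=> // CC tCC /=; split=> [tauC|CCC].
    apply: contrapT => nC; move: tauC; apply/tangle_compl => //.
    apply: tangle_subset tC => //; first exact: tame_sets_compl.
    by move=> _ ->.
  by apply: tangle_subset tC => // _ ->.
(* A finite set is a finite union of singletons, one of which would have to be in the
   ultrafilter. *)
have nfin CC : CC `<=` components X -> finite_set CC -> ~ tau (sep_to X CC).
  move=> sCC fin tCC; apply: nsingle.
  have [|||_ [C CCC <-] tC] := @tangle_bigcup tau X (set1 @` CC) tt.
  - exact: finite_image.
  - by move=> _ [C CCC <-]; apply: tame_sets_finite => // _ ->; exact: sCC.
  - rewrite bigcup_image; have -> // : \bigcup_(C in CC) [set C] = CC.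
    by apply/seteqP; split=> [C [D DD ->]|C CCC]; [|exists C].
  - by exists C => //; exact: sCC.
(* The classes of the finitely many [Y] inside [X] cover all components, so one class is in the
   ultrafilter. By [nfin] it is infinite, which makes [Y] critical. *)
have [|||_ [Y YX <-] tY] := @tangle_bigcup tau X
    (components_nbr X @` [set Y | Y `<=` X]) tt.
- by apply: finite_image; apply: finite_powerset; exact: svalP.
- by move=> _ [Y _ <-]; exact: tame_sets_nbr.
- rewrite bigcup_image; have -> : \bigcup_(Y in [set Y | Y `<=` X])
      components_nbr X Y = components X; last exact: tangle_components.
  apply/seteqP; split=> [C [Y _ []]//|C cC].
  by exists (neighborhood C) => //; exact: neighborhood_component.
have XY : crit_sub X Y.
  split=> //; apply: (infinite_crit (svalP X)) => // fin.
  by apply: nfin tY => // C [].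
(* [CC] and a finite remainder cover the class of [Y], and [nfin] rules out the remainder. *)
have up CC : tame_sets X CC -> finite_set (components_nbr X Y `\` CC) ->
    tau (sep_to X CC).
  move=> tCC fin; have tD : tame_sets X (components_nbr X Y `\` CC).
    by apply: tame_sets_finite fin => C [[]].
  have [|//|] := tangle_setU tt tCC tD.
    apply: tangle_subset tY => //; first exact: tame_setsU.
    by move=> C YC; have [|] := pselect (CC C); [left|right].
  by move=> /nfin; case=> //; case: tD.
exists (inr Y); apply/phi_specP; split=> // CC tCC; split; last exact: up.
move=> tauC; apply: contrapT => /(concentrates_compl _ tCC) -/(_ XY) /= fin.
move: tauC; apply/tangle_compl => //.
by apply: up => //; exact: tame_sets_compl.
Qed.

Lemma phiP tau X : tame_tangles tau -> phi_spec tau X (phi X tau).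
Proof. by move=> tt; have [g gX] := phi_spec_exists X tt; exact: xgetI gX. Qed.

(* [sep_to X CC] and the separation [s] at [X'] need not be nested; both lie
   below [r], whose separator is [X] together with the part of [X'] inside the
   components in [CC], and both differ from [r] by finitely many vertices. *)
Lemma tangle_preimage tau (X X' : finsub G) CC : tame_tangles tau ->
  X `<=` X' -> tame_sets X CC ->
  tau (sep_to X CC) <-> tau (sep_to X' (component_preimage X' X CC)).
Proof.
move=> tt XX' tCC; have [sCC _] := tCC.
pose V := union_vertices CC; have [finX finX'] := (svalP X, svalP X').
have finX1 : finite_set ((X : set G) `|` (X' `&` V)).
  by rewrite finite_setU; split=> //; exact: finite_setIl.
pose X1 : finsub G := exist _ _ finX1.
have XX1 : X `<=` X1 by exact: subsetUl.
pose r := sep_to X1 (component_preimage X1 X CC).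
have tr : is_tame_separation r.
  exact/tame_sep_to/tame_component_preimage.
pose s := sep_to X' (component_preimage X' X CC).
have ts : is_tame_separation s.
  exact/tame_sep_to/tame_component_preimage.
have tp := tame_sep_to tCC.
have XV v : V v -> ~ (X : set G) v by exact: union_vertices_notin.
have pr : sep_le (sep_to X CC) r.
  rewrite /r /sep_to union_vertices_preimage // -/V; split=> v /=.
    by move=> nV [].
  by case=> [[Xv|[_ Vv]]|[Vv _]]; [left|right|right].
have sr : sep_le s r.
  rewrite /s /r /sep_to !union_vertices_preimage // -/V; split=> v /=.
    move=> nV [Vv nX1]; apply: nV; split=> // X'v; apply: nX1; right; by split.
  case=> [[/XX' Xv|[X'v Vv]]|[Vv nX1]]; [by left|by left|].
  have [X'v|X'v] := pselect ((X' : set G) v); first by left.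
  by right; split.
transitivity (tau r).
  split=> [tauC|tr']; last exact: tangle_le tr' pr.
  apply: tangle_le_finite tauC pr _ => //.
  apply: sub_finite_set (finX1) => v.
  rewrite /r /sep_to union_vertices_preimage // -/V => -[[Xv|Vv] /= nV].
    by left.
  by apply: contrapT => nX1; apply: nV.
split=> [tr'|taus]; first exact: tangle_le tr' sr.
apply: tangle_le_finite taus sr _ => //.
apply: sub_finite_set finX' => v.
rewrite /s /r /sep_to !union_vertices_preimage // -/V /=.
case=> [[//|[Vv X'v]] nV]; apply: contrapT => _; apply: nV; split=> //.
by case=> [/XX'|[]].
Qed.

(** The image under [bonding] of the place at [X'] describes the ultrafilter at [X] too, and a place
    is determined by its ultrafilter. *)
Lemma phi_Gamma tau : tame_tangles tau -> Gamma (fun X => phi X tau).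
Proof.
move=> tt; split=> [X|X X' XX']; first by have [] := phiP X tt.
have /phi_specP[X'g hg] := phiP X' tt.
apply: phi_spec_unique (phiP X tt); apply/phi_specP; split.
  exact: bonding_Gamma.
move=> CC tCC; rewrite (tangle_preimage tt XX' tCC) hg.
  exact: concentrates_preimage.
exact: tame_component_preimage.
Qed.

Lemma phi_inj tau tau' : tame_tangles tau -> tame_tangles tau' ->
  (fun X => phi X tau) = (fun X => phi X tau') -> tau = tau'.
Proof.
have sub t t' : tame_tangles t -> tame_tangles t' ->
    (fun X => phi X t) = (fun X => phi X t') -> t `<=` t'.
  move=> tt tt' eqphi p tp.
  have /tame_separationP[X [CC [tCC pE]]] : is_tame_separation p.
    by case: tt => -[st _] _ _; exact: st.
  have /phi_specP[_ h] := phiP X tt; have /phi_specP[_ h'] := phiP X tt'.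
  move: tp; rewrite pE => /(h _ tCC).
  by rewrite (congr1 (@^~ X) eqphi : phi X t = phi X t') => /(h' _ tCC).
by move=> tt tt' eqphi; apply/seteqP; split; apply: sub.
Qed.

(** * The tangle of a limit *)

Definition tangle_of (g : finsub G -> place G) : set (oriented G) :=
  [set p | exists X CC,
    [/\ tame_sets X CC, concentrates X (g X) CC & p = sep_to X CC]].

Lemma finsub_inj X Y : X = Y :> set G -> X = Y.
Proof.
by case: X Y => X hX [Y hY] /= e; subst; congr exist; exact: Prop_irrelevance.
Qed.

Lemma tangle_ofP g X CC : tame_sets X CC ->
  tangle_of g (sep_to X CC) <-> concentrates X (g X) CC.
Proof.
move=> tCC; split=> [[Y [DD [tDD cDD /sep_to_inj]]]|]; last by exists X, CC.
by move=> /(_ tCC.1 tDD.1)[/finsub_inj -> ->].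
Qed.

(* Pull the separations in [sigma] back to one large [W]: the place [g W] makes
   finitely many sets of components of G - W meet, and any vertex [v] of a
   common component will do. *)
Lemma tangle_of_finite g sigma (Z : set G) : Gamma g ->
  sigma `<=` tangle_of g -> finite_set sigma -> finite_set Z ->
  exists2 v, ~ Z v & forall p, sigma p -> p.2 v /\ ~ p.1 v.
Proof.
move=> [gX gf] ssigma finS finZ.
have /choice[h hP] : forall p, exists XC : finsub G * set (set G), sigma p ->
    [/\ tame_sets XC.1 XC.2, concentrates XC.1 (g XC.1) XC.2 &
        p = sep_to XC.1 XC.2].
  move=> p; have [sp|] := pselect (sigma p); last first.
    by exists (exist _ _ (finite_set0 _), set0).
  by have [X [CC ?]] := ssigma _ sp; exists (X, CC).
have finW : finite_set (Z `|` \bigcup_(p in sigma) ((h p).1 : set G)).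
  rewrite finite_setU; split=> //.
  by apply: bigcup_finite => // p _; exact: svalP.
pose W : finsub G := exist _ _ finW.
have sW p : sigma p -> (h p).1 `<=` W by move=> sp v hv; right; exists p.
have [||C cC hC] := @concentrates_finite G W (g W)
  ((fun p => component_preimage W (h p).1 (h p).2) @` sigma) (gX W).
- exact: finite_image.
- move=> _ [p sp <-]; apply/concentrates_preimage => //; first exact: sW.
  by rewrite gf; [have [] := hP p sp|exact: sW].
have [v Cv] := components_neq0 cC; exists v.
  by move=> Zv; apply: components_notin cC Cv _; left.
move=> p sp; have [[sCC _] _ pE] := hP p sp.
have Vv : union_vertices (h p).2 v.
  have [_ CCC] : component_preimage W (h p).1 (h p).2 C by apply: hC; exists p.
  exists (component_map (h p).1 C) => //.
  by have [_] := component_map_sub (sW p sp) cC; apply.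
by rewrite pE /=; split; [right|].
Qed.

Lemma tangle_of_tangle g : Gamma g -> tame_tangles (tangle_of g).
Proof.
move=> Gg; have [gX gf] := Gg.
have sub : tangle_of g `<=` @is_tame_separation G.
  by move=> p [X [CC [tCC _ ->]]]; exact: tame_sep_to.
split.
- split=> // p /tame_separationP[X [CC [tCC ->]]].
  have tCC' := tame_sets_compl tCC.
  rewrite flip_sep_to; last by case: tCC.
  have C := concentrates_compl (gX X) tCC.
  have [cCC|/C cCC] := pselect (concentrates X (g X) CC).
    exists (sep_to X CC); split; first by split; [left|apply/tangle_ofP].
    by move=> _ [[->//|->] /(tangle_ofP _ tCC')/C].
  exists (sep_to X (components X `\` CC)).
  split; first by split; [right|apply/tangle_ofP].
  by move=> _ [[->|->//] /(tangle_ofP _ tCC)]; move/C: cCC.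
(* A vertex in both big sides and in neither small side contradicts the inclusion of [p.2] in
   [q.1]. *)
- move=> p q tp tq _ [[pq _] _].
  have [|||v _ hv] := @tangle_of_finite g [set p; q] set0 Gg => //.
    by move=> r [] ->.
  have [p2 _] := hv p (or_introl erefl); have [_ q1] := hv q (or_intror erefl).
  exact/q1/pq.
(* The finite set to avoid is the interior itself, yet the vertex found lies in every big side. *)
- move=> [sigma [ssigma finS _ finI]].
  have [v Iv hv] := tangle_of_finite Gg ssigma finS finI.
  by apply: Iv => p /hv[].
Qed.

Lemma phi_tangle_of g : Gamma g -> (fun X => phi X (tangle_of g)) = g.
Proof.
move=> Gg; apply: funext => X.
apply: phi_spec_unique (phiP X (tangle_of_tangle Gg)) _.
apply/phi_specP; split; first by case: Gg.
by move=> CC tCC; exact: tangle_ofP.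
Qed.

End TangleFilter.

(** * Directions are given by rays *)

Section Directions.
Variable G : graph.
Implicit Types (X S P : finsub G) (T U : set G) (d : finsub G -> set G).
Local Notation V := {classic G}.

Definition direction d :=
  (forall X, components X (d X)) /\
  (forall X X', X `<=` X' -> d X' `<=` d X).

Definition absorbing d T := forall P, P `&` T = set0 -> T `<=` d P.

Definition finsubU X X' : finsub G :=
  exist _ (X `|` X')
    (eq_ind_r id (conj (svalP X) (svalP X')) (finite_setU X X')).

Definition finsub_seq (s : seq V) : finsub G :=
  exist _ [set` s] ((finite_seqP (T := V) [set` s]).2 (ex_intro _ s erefl)).

Lemma finsub_seqE s (v : G) : (finsub_seq s : set G) v = ((v : V) \in s).
Proof. by []. Qed.

Lemma walk_exit U (P : set G) u v : walk U u v -> P u -> ~ P v ->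
  exists a b, [/\ P a, ~ P b, adj a b & U b].
Proof.
elim=> [//|a b c Ua ab bc IH Pa nPc].
have [Pb|nPb] := pselect (P b); first exact: IH.
by exists a, b; split=> //; have [] := walk_mem bc.
Qed.

Definition adjb : rel V := fun a b => `[< adj a b >].

Lemma path_first_hit U T (u v : V) : walk U u v -> T v ->
  exists p : seq V, [/\ path adjb u p,
    uniq ((u : V) :: p), forall x, x \in (u : V) :: p -> U x,
    T (last u p) & forall x, x \in (u : V) :: p -> T x -> x = last u p].
Proof.
elim=> [a Ua Ta|a b c Ua ab bc IH /IH[p [ep up pU Tp pT]]].
  by exists [::]; split=> // x; rewrite inE => /eqP ->.
have [Ta|nTa] := pselect (T a).
  by exists [::]; split=> // x; rewrite inE => /eqP ->.
have eap : path adjb a (b :: p).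
  by apply/andP; split=> //; exact/asboolP.
have lastE : last (a : V) (b :: p) = last (b : V) p by [].
(* Prepending [a] may repeat a vertex; shortening keeps the last vertex and introduces no new
   ones. *)
case: {-}_ / (shortenP (T := V) eap) lastE => p' ep' up' sp' lastE.
exists p'; split=> //.
- by move=> x; rewrite inE => /predU1P[->//|/sp'/pU].
- by rewrite lastE.
- move=> x; rewrite inE lastE => /predU1P[->//|/sp'/pT]; exact.
Qed.

Lemma direction_adj d X u v :
  direction d -> d X u -> adj u v -> ~ (X : set G) v -> d X v.
Proof. by move=> [dX _]; apply: components_adj. Qed.

(** The connected set [d X] avoids [P], so it lies in one component of G - P. That component is
    [d P], since the choice of [d] at the union of [X] and [P] lies in both. *)
Lemma direction_absorbing d X : direction d -> absorbing d (d X).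
Proof.
move=> [dX dle] P PX; have [_ cX _] := dX X.
apply: (components_absorb (dX P)) => // [v Xv Pv|].
  by have : (P `&` d X) v by []; rewrite PX.
have [v dv] := components_neq0 (dX (finsubU X P)).
by exists v; split; apply: dle dv; [exact: subsetUr|exact: subsetUl].
Qed.

(** A walk inside [d X] from [d S] to [v] can leave [d S] only into [S], and [v] is the only vertex
    of [S] in [d X]. *)
Lemma direction_exit d X S v : direction d -> d X v -> X `<=` S ->
  S `<=` v |` X -> (S : set G) v -> exists2 y, adj v y & d S y.
Proof.
move=> dd dv XS Sv Svv; have [dX dle] := dd.
have [z Sz] := components_neq0 (dX S).
have [_ [_ cX] _] := dX X.
have [|a [b [Sa nSb ab Xb]]] := walk_exit (cX z v (dle _ _ XS z Sz) dv) Sz.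
  by move=> /(components_notin (dX S)).
have [Sb|] := pselect ((S : set G) b); last by move/(direction_adj dd Sa ab).
have [bv|Xb'] := Sv b Sb; last by case: (components_notin (dX X) Xb Xb').
by exists a => //; apply: adj_sym; rewrite -bv.
Qed.

(* The ray is a union of growing paths. The invariant is that the last vertex
   lies in [d P] for [P] the set of earlier vertices; a path from there that
   stops at its first vertex in an absorbing set [T] keeps this true, because
   the vertices before it avoid [T]. *)
Lemma ray_through d (Q : nat -> set G) : direction d ->
  (forall k S, exists T, [/\ T !=set0, S `&` T = set0, T `<=` Q k &
     absorbing d T]) ->
  exists2 r, is_ray r & forall k, exists2 n, (k <= n)%N & Q k (r n).
Proof.
move=> dd hT; have [dX dle] := dd.
have [x0 dx0] : exists x0 : V, d (finsub_seq [::]) x0.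
  exact: components_neq0 (dX _).
pose inv (l : seq V) := [/\ path adjb x0 l, uniq (x0 :: l) &
  d (finsub_seq (belast x0 l)) (last x0 l)].
have step k l : inv l ->
    exists (y : V) p, inv (l ++ y :: p) /\ Q k (last y p).
  move=> [el ul dl]; pose S := finsub_seq (x0 :: l).
  have [T [[t Tt] ST TQ aT]] := hT k S.
  have lE := lastI x0 l.
  have [y ly Sy] : exists2 y : V, adj (last x0 l) y & d S y.
    apply: direction_exit dd dl _ _ _ => [v|v|]; rewrite !finsub_seqE lE.
    - by rewrite mem_rcons inE orbC => ->.
    - by rewrite mem_rcons inE => /predU1P[]; [left|right].
    - by rewrite mem_rcons inE eqxx.
  have St : d S t by exact: aT.
  have [_ [_ cS] _] := dX S.
  have [p [ep up pS Tp pT]] := path_first_hit (cS y t Sy St) Tt.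
  exists y, p; split; last exact: TQ.
  split.
  - by rewrite cat_path el /= ep andbT; apply/asboolP.
  - rewrite -cat_cons cat_uniq ul up andbT; apply/hasPn => x /pS Sx.
    by apply/negP; exact: components_notin (dX S) Sx.
  (* The old vertices miss [T] because [T] avoids [S]; the new ones before the last miss it because
     the path stops at its first hit. *)
  - rewrite last_cat /= belast_cat; apply: aT => //.
    rewrite -subset0 => v []; rewrite finsub_seqE mem_cat inE orbA.
    move=> /orP[vl|vp] Tv.
      have : (S `&` T) v; last by rewrite ST.
      by split=> //; rewrite finsub_seqE lE mem_rcons inE orbC.
    have vy : @in_mem V v (mem (y :: p)) by rewrite lastI mem_rcons inE vp orbT.
    move: up; rewrite lastI rcons_uniq -(pT v vy Tv) => /andP[].
    by rewrite vp.
pose st := {s : nat * seq V | inv s.2}.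
pose R (s s' : st) := (sval s').1 = (sval s).1.+1 /\
  exists (y : V) p,
    (sval s').2 = (sval s).2 ++ y :: p /\ Q (sval s).1 (last y p).
have inv0 : inv [::] by [].
have /dependent_choice/(_ (exist _ (0, [::]) inv0))[f [f0 fS]] :
    forall s, {s' | R s s'}.
  move=> [[k l] /= il]; apply: cid; have [y [p [il' Qp]]] := step k l il.
  by exists (exist _ (k.+1, l ++ y :: p) il'); split=> //; exists y, p.
pose L n := (sval (f n)).2.
have fk n : (sval (f n)).1 = n.
  by elim: n => [|n IH]; [rewrite f0|rewrite (fS n).1 IH].
have LS n : exists (y : V) p, L n.+1 = L n ++ y :: p /\ Q n (last y p).
  by have [_] := fS n; rewrite fk.
have invL n : inv (L n) by exact: svalP (f n).
have Lsz n : (n <= size (L n))%N.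
  elim: n => // n IH; have [y [p [-> _]]] := LS n.
  by rewrite size_cat /= addnS ltnS (leq_trans IH) ?leq_addr.
have Lpre m n : exists q, L (m + n) = L m ++ q.
  elim: n => [|n [q IH]]; first by exists [::]; rewrite addn0 cats0.
  have [y [p [E _]]] := LS (m + n).
  by exists (q ++ y :: p); rewrite addnS E IH catA.
(* Stage [j] already has more than [j] vertices, and later stages only extend it, so the default
   [x0] is never returned. *)
pose r j : V := nth x0 (x0 :: L j) j.
have pre m n j : (m <= n)%N -> (j <= size (L m))%N ->
    nth x0 (x0 :: L n) j = nth x0 (x0 :: L m) j.
  move=> mn jm; have [q] := Lpre m (n - m); rewrite subnKC // => ->.
  by rewrite -cat_cons nth_cat /= ltnS jm.
have rE m j : (j <= size (L m))%N -> r j = nth x0 (x0 :: L m) j.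
  move=> jm; have [mj|/ltnW jm'] := leqP m j; first exact: pre.
  by rewrite /r -(pre j m).
exists r.
  split=> [i j eqij|j].
    have [_ + _] := invL (maxn i j); move=> /(nth_uniq x0) h.
    have ile : (i <= size (L (maxn i j)))%N.
      by apply: leq_trans (Lsz _); exact: leq_maxl.
    have jle : (j <= size (L (maxn i j)))%N.
      by apply: leq_trans (Lsz _); exact: leq_maxr.
    by apply/eqP; rewrite -(h i j) // -!rE // eqij.
  have [/(pathP x0) h _ _] := invL j.+1.
  have /asboolP := h j (Lsz _).
  by rewrite (rE j.+1 j) 1?(rE j.+1 j.+1) // ltnW.
(* With [x0] at index 0, this is the index of the last vertex of stage [k.+1], which was chosen in
   [Q k]. *)
move=> k; exists (size (L k.+1)); first exact: leq_trans (Lsz _).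
have [y [p [E Qp]]] := LS k.
by rewrite (rE k.+1) // -last_nth E last_cat.
Qed.

Lemma direction_ray d : direction d ->
  exists2 r, is_ray r & forall X, has_tail_in r (d X).
Proof.
move=> dd; have [dX dle] := dd.
(* If infinitely many vertices [u] satisfy [d X u] whenever [u] is outside [X],
   a ray through infinitely many of them works. Otherwise finite sets [W n] can
   be chosen so that the sets [d (W n)] have empty intersection, and a ray that
   visits all of these works. *)
pose U : set G := [set u | forall X, ~ (X : set G) u -> d X u].
(* A ray has a tail in some component of G - X; a vertex of that tail in [d X] identifies the
   component. *)
have tail r X : is_ray r ->
    (forall n, exists2 m, (n <= m)%N & ~ (X : set G) (r m) -> d X (r m)) ->
    has_tail_in r (d X).
  move=> ray hits; have [C cC [n Cn]] := ray_tail (svalP X) ray.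
  have [m nm Xdm] := hits n; have Cm := Cn m nm.
  have dm := Xdm (components_notin cC Cm).
  by rewrite (components_unique (dX X) cC dm Cm); exists n.
have [finU|infU] := pselect (finite_set U); last first.
  have [k S|r ray hits] := @ray_through d (fun=> U) dd.
    exists (U `\` S); split.
    - exact: infinite_setN0 (infinite_setD infU (svalP S)).
    - by rewrite setIC setDKI.
    - exact: subDsetl.
    - move=> P PT u [Uu Su]; apply: (Uu P) => Pu.
      by have : (P `&` (U `\` S)) u by []; rewrite PT.
  exists r => // X; apply: tail => // n.
  by have [m nm Um] := hits n; exists m => // /Um.
have /choice[Z hZ] : forall x, exists Z : finsub G,
    ~ U x -> ~ (Z : set G) x /\ ~ d Z x.
  move=> x; have [Ux|] := pselect (U x); first by exists (finsub_seq [::]).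
  by move=> /existsNP[Z /not_implyP ?]; exists Z.
(* One step of the sequence [W]: add the witnesses [Z x] and a vertex of [d X], so that [d] shrinks
   strictly. *)
have /choice[g hg] : forall X, exists X', [/\ X `<=` X',
    forall x, (X : set G) x -> ~ U x -> Z x `<=` X' &
    exists2 x, d X x & (X' : set G) x].
  move=> X; have [y dy] := components_neq0 (dX X).
  have fin : finite_set (y |` (X `|` \bigcup_(x in X) (Z x : set G))).
    rewrite !finite_setU; split; first exact: finite_set1.
    split; first exact: svalP.
    by apply: bigcup_finite => [|x _]; exact: svalP.
  exists (exist _ _ fin); split.
  - by move=> v Xv; right; left.
  - by move=> x Xx _ v Zv; right; right; exists x.
  - by exists y => //; left.
pose W n := iter n g (exist _ _ finU : finsub G).
have WS n : W n `<=` W n.+1 by have [] := hg (W n).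
have Wle m n : (m <= n)%N -> W m `<=` W n.
  move/subnKC <-; elim: (n - m)%N => [|k IH] v; first by rewrite addn0.
  by rewrite addnS => /IH/WS.
(* Otherwise a walk in [d (W 0)] from the intersection [D] to a vertex of [W 1] leaves [D] by an
   edge from [a] to [b], with [b] in some [W n] and outside [U]. As [Z b] lies in [W n.+1], [a] is
   in [d (Z b)], hence so is [b], contrary to the choice of [Z b]. *)
have dW v : exists n, ~ d (W n) v.
  apply: contrapT => /forallNP dv.
  pose D : set G := [set v | forall n, d (W n) v].
  have Dv : D v by move=> n; apply: contrapT => /dv.
  have [_ _ [z dz Wz]] := hg (W 0).
  have [_ [_ c0] _] := dX (W 0).
  have [|a [b [Da nDb ab b0]]] := walk_exit (c0 v z (Dv 0) dz) Dv.
    by move=> /(_ 1) /(components_notin (dX _)).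
  have [n nb] := (existsNP _).2 nDb.
  have Wb : (W n : set G) b.
    by apply: contrapT => /(direction_adj dd (Da n) ab).
  have nUb : ~ U b by exact: components_notin (dX (W 0)) b0.
  have [Zb ndb] := hZ b nUb; apply: ndb.
  apply: direction_adj dd _ ab Zb; apply: dle (Da n.+1).
  by have [_ + _] := hg (W n); apply.
have [k S|r ray hits] := @ray_through d (fun k => d (W k)) dd.
  exists (d (finsubU S (W k))); split.
  - exact: components_neq0 (dX _).
  - by rewrite -subset0 => v [Sv] /(components_notin (dX _)); apply; left.
  - by apply: dle; exact: subsetUr.
  - exact: direction_absorbing.
exists r => // X; apply: tail => // n.
(* The decreasing sets [d (W k)] have empty intersection, so one of them avoids the finite set [X]
   and is then absorbed by [d X]. *)
have [k hk] : exists k, forall v, (X : set G) v -> ~ d (W k) v.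
  case: X => X finX /=; rewrite /finsub_set /=.
  move: X finX; apply: finite_set_ind => [|v A _ [k hk]]; first by exists 0.
  have [m nv] := dW v; exists (maxn k m) => u [->|/hk nu] du.
    by apply: nv; apply: dle du; apply: Wle; exact: leq_maxr.
  by apply: nu; apply: dle du; apply: Wle; exact: leq_maxl.
have [m mn dm] := hits (maxn k n).
exists m => [|_]; first by apply: leq_trans mn; exact: leq_maxr.
apply: (direction_absorbing (X := W k) dd).
  by rewrite -subset0 => v [/hk].
by apply: dle dm; apply: Wle; exact: leq_maxl.
Qed.

End Directions.

(** * Ends and critical sets *)

Section EndsAndCriticalSets.
Variable G : graph.
Implicit Types (X : finsub G) (Y : set G) (omega : set (nat -> G)).

Lemma end_component_tail X omega r :
  ends omega -> omega r -> has_tail_in r (end_component X omega).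
Proof.
move=> /(end_component_spec X)[_ h] or.
by have [_] := (h (end_component X omega)).2 erefl; apply.
Qed.

Lemma ends_nonempty omega : ends omega -> omega !=set0.
Proof.
move=> [r ray ->]; exists r; split=> // X.
by have [C cC rC] := ray_tail (svalP X) ray; exists C.
Qed.

Lemma end_point_Gamma omega : ends omega -> Gamma (end_point omega).
Proof.
move=> eom; split=> [X|X X' XX'] /=.
  by have [] := end_component_spec X eom.
congr inl; have [cE _] := end_component_spec X eom.
have [cE' _] := end_component_spec X' eom.
have [cM EM] := component_map_sub XX' cE'.
have [r omr] := ends_nonempty eom.
apply: tail_components_eq cM cE _ (end_component_tail X eom omr).
by have [n rn] := end_component_tail X' eom omr; exists n => m /rn/EM.
Qed.

Lemma crit_point_Gamma Y : crit Y -> Gamma (crit_point Y).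
Proof.
move=> cY; split=> [X|X X' XX']; rewrite /crit_point.
  case: asboolP => [//|YX] /=.
  by have [] := component_meeting_spec (svalP X) cY YX.
case: (asboolP (Y `<=` X)) => YX.
  have YX' : Y `<=` X' by exact: subset_trans XX'.
  by rewrite asboolT //= asboolT.
have nXY : ~ crit_sub X Y by case.
case: asboolP => YX' /=; first by rewrite asboolF.
congr inl; apply/(component_meeting_spec (svalP X) cY YX).2.
have [cM h] := component_meeting_spec (svalP X') cY YX'.
have [_ [v [Mv Yv]]] := (h (component_meeting X' Y)).2 erefl.
have [cD MD] := component_map_sub XX' cM.
by split=> //; exists v; split=> //; exact: MD.
Qed.

Lemma crit_point_self Y (cY : crit Y) : crit_point Y (exist _ Y cY.1) = inr Y.
Proof. by rewrite /crit_point asboolT. Qed.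

(** Rays of the two ends have tails in the same component of G - X for every [X], which is their
    equivalence. *)
Lemma end_point_inj omega omega' : ends omega -> ends omega' ->
  end_point omega = end_point omega' -> omega = omega'.
Proof.
have sub (o o' : set (nat -> G)) : ends o -> ends o' ->
    end_point o = end_point o' -> o `<=` o'.
  move=> eo eo' eqp r or; have [r' or'] := ends_nonempty eo'.
  have rayr : is_ray r by case: eo or => ? _ -> [].
  case: (eo') or' => s rays o'E; rewrite o'E => -[rayr' ss].
  split=> // X; exists (end_component X o'); split.
  - by have [] := end_component_spec X eo'.
  - apply: end_component_tail => //; rewrite o'E; split=> // Z.
    by have [C cC sC] := ray_tail (svalP Z) rays; exists C.
  - have [->] : end_point o' X = end_point o X by rewrite eqp.
    exact: end_component_tail.
by move=> eo eo' eqp; apply/seteqP; split; apply: sub.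
Qed.

Lemma crit_point_inj Y Y' : crit Y -> crit_point Y = crit_point Y' -> Y = Y'.
Proof.
move=> cY /(congr1 (@^~ (exist _ Y cY.1))); rewrite crit_point_self.
by rewrite /crit_point; case: asboolP => // _ [].
Qed.

(** [bonding] never sends a component to a critical set, so the entry at the union of [X] and [Z]
    must be [Y] again; it determines the entry at [Z]. *)
Lemma Gamma_crit_point (g : finsub G -> place G) X Y :
  Gamma g -> g X = inr Y -> g = crit_point Y.
Proof.
move=> [gX gf] gXY; have [cY YX] : crit_sub X Y by have := gX X; rewrite gXY.
apply: funext => Z; have XU : X `<=` finsubU X Z by exact: subsetUl.
have <- : bonding (finsubU X Z) Z (g (finsubU X Z)) = g Z.
  by apply: gf; exact: subsetUr.
have := gf _ _ XU; rewrite gXY; case: (g _) => //= Y'.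
case: asboolP => // _ [->]; rewrite /crit_point.
case: (asboolP (Y `<=` Z)) => YZ; first by rewrite asboolT.
by rewrite asboolF // => -[].
Qed.

Lemma Gamma_end_point (g : finsub G -> place G) (d : finsub G -> set G) :
  Gamma g -> (forall X, g X = inl (d X)) -> exists2 omega, ends omega &
  end_point omega = g.
Proof.
move=> [gX gf] gd; have dX X : components X (d X) by have := gX X; rewrite gd.
have [|r ray rd] := @direction_ray G d.
  split=> // X X' XX'; have := gf _ _ XX'; rewrite !gd => -[<-].
  by have [] := component_map_sub XX' (dX X').
pose omega := [set r' | is_ray r' /\ ray_equiv r r'].
have eom : ends omega by exists r.
exists omega => //; apply: funext => X; rewrite gd; congr inl; apply/esym.
apply/(end_component_spec X eom).2.
split=> // r' [_ /(_ X)[C [cC rC r'C]]].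
by rewrite (tail_components_eq (dX X) cC (rd X) rC).
Qed.

Lemma Gamma_ends_crit :
  @Gamma G = (@end_point G @` @ends G) `|` (@crit_point G @` @crit G).
Proof.
apply/seteqP; split=> [g Gg|g [[omega eom <-]|[Y cY <-]]]; last 1 first.
- exact: crit_point_Gamma.
- have [[X [Y gXY]]|ncrit] := pselect (exists X Y, g X = inr Y).
    right; exists Y; last by rewrite (Gamma_crit_point Gg gXY).
    by case: (Gg) => /(_ X); rewrite gXY => -[].
  have /choice[d gd] : forall X, exists C, g X = inl C.
    move=> X; case E: (g X) => [C|Y]; first by exists C.
    by case: ncrit; exists X, Y.
  left; exact: (Gamma_end_point Gg gd).
- exact: end_point_Gamma.
Qed.

End EndsAndCriticalSets.

Theorem theorem5p10 (G : graph) :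
  [/\ forall tau : set (oriented G), tame_tangles tau ->
        forall X : finsub G, exists! p : place G, phi_spec tau X p,
      set_bij (@tame_tangles G) (@Gamma G)
        (fun tau (X : finsub G) => phi X tau) &
      [/\ @Gamma G = (@end_point G @` @ends G) `|` (@crit_point G @` @crit G),
          (@end_point G @` @ends G) `&` (@crit_point G @` @crit G) = set0,
          set_inj (@ends G) (@end_point G) &
          set_inj (@crit G) (@crit_point G)]].
Proof.
split.
- move=> tau tt X; have [p pX] := phi_spec_exists X tt.
  by exists p; split=> // q; exact: phi_spec_unique.
- split.
  + by move=> tau; exact: phi_Gamma.
  + by move=> tau tau' /set_mem tt /set_mem tt'; exact: phi_inj.
  + move=> g Gg; exists (tangle_of g); first exact: tangle_of_tangle.
    exact: phi_tangle_of.
- split.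
  + exact: Gamma_ends_crit.
  (* At the index [Y] the limit [crit_point Y] takes a critical set as its value, while an end
     yields a component at every index. *)
  + rewrite -subset0 => g [[omega _ <-] [Y cY]].
    move=> /(congr1 (@^~ (exist _ Y cY.1))); rewrite crit_point_self.
    by [].
  + by move=> o o' /set_mem eo /set_mem eo'; exact: end_point_inj.
  + by move=> Y Y' /set_mem cY _; exact: crit_point_inj.
Qed.
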